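(* For every integer $n\geq 3$, $m_3(nK_2,C_7) = n$.
   Context: $K_{3\times t}$ denotes the complete 3-partite graph with three partite classes of size $t$. $m_3(G_1,G_2)$ is the smallest positive integer $t$ such that every 2-coloring of the edges of $K_{3\times t}$ contains a copy of $G_1$ in color 1 or a copy of $G_2$ in color 2. $nK_2$ is the matching of $n$ disjoint edges and $C_7$ the cycle on 7 vertices. *)

(* Defs.v *)
From mathcomp Require Import all_boot.
Set Implicit Arguments.
Unset Strict Implicit.
Unset Printing Implicit Defensive.

Record sgraph := SGraph {
  vertex :> finType;
  adj : rel vertex;
  adj_sym : symmetric adj;
  adj_irrefl : irreflexive adj }.

(* A copy of G in H is a subgraph of H isomorphic to G, not necessarily
   induced. *)
Definition contains_copy (H G : sgraph) : Prop :=
  exists2 f : G -> H, injective f & forall x y, adj x y -> adj (f x) (f y).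

Section CompleteMultipartite.
Variables j t : nat.

(* (a, i) is the i-th vertex of the a-th partite class. *)
Definition multipartite_adj : rel ('I_j * 'I_t) := fun x y => x.1 != y.1.

Lemma multipartite_sym : symmetric multipartite_adj.
Proof. by move=> x y; rewrite /multipartite_adj eq_sym. Qed.

Lemma multipartite_irrefl : irreflexive multipartite_adj.
Proof. by move=> x; rewrite /multipartite_adj eqxx. Qed.

Definition complete_multipartite : sgraph :=
  SGraph multipartite_sym multipartite_irrefl.

End CompleteMultipartite.

Section Matching.
Variable n : nat.

(* The i-th edge joins (i, false) and (i, true). *)
Definition matching_adj : rel ('I_n * bool) :=
  fun x y => (x.1 == y.1) && (x.2 != y.2).

Lemma matching_sym : symmetric matching_adj.
Proof.
by move=> x y; rewrite /matching_adj (eq_sym x.1) (eq_sym x.2).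
Qed.

Lemma matching_irrefl : irreflexive matching_adj.
Proof. by move=> x; rewrite /matching_adj !eqxx. Qed.

Definition matching_graph : sgraph := SGraph matching_sym matching_irrefl.

End Matching.

Section Cycle.
Variable k : nat.

(* This is the cycle C_k for k >= 3 only. *)
Definition cycle_adj : rel 'I_k :=
  fun x y => (x != y) && ((y == x.+1 %[mod k]) || (x == y.+1 %[mod k])).

Lemma cycle_sym : symmetric cycle_adj.
Proof. by move=> x y; rewrite /cycle_adj (eq_sym x y) orbC. Qed.

Lemma cycle_irrefl : irreflexive cycle_adj.
Proof. by move=> x; rewrite /cycle_adj eqxx. Qed.

Definition cycle_graph : sgraph := SGraph cycle_sym cycle_irrefl.

End Cycle.

Section ColorClass.
Variables (G : sgraph) (c : {set G} -> bool) (b : bool).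

(* c colors the edge xy by c [set x; y]; its values on sets that are not edges
   of G are never used. *)
Definition color_adj : rel G := fun x y => adj x y && (c [set x; y] == b).

Lemma color_sym : symmetric color_adj.
Proof. by move=> x y; rewrite /color_adj adj_sym setUC. Qed.

Lemma color_irrefl : irreflexive color_adj.
Proof. by move=> x; rewrite /color_adj adj_irrefl. Qed.

Definition color_class : sgraph := SGraph color_sym color_irrefl.

End ColorClass.

(* Color 1 is [true] and color 2 is [false]. *)
Definition arrows (H G1 G2 : sgraph) : Prop :=
  forall c : {set H} -> bool,
    contains_copy (color_class c true) G1 \/
    contains_copy (color_class c false) G2.

(* m_j(G1, G2) = t. It is a relation because m_j(G1, G2) need not exist for
   arbitrary j, G1, G2. *)
Definition multipartite_ramsey (j : nat) (G1 G2 : sgraph) (t : nat) : Prop :=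
  [/\ 0 < t,
      arrows (complete_multipartite j t) G1 G2
    & forall s, 0 < s -> arrows (complete_multipartite j s) G1 G2 -> t <= s].

(* Main.v *)
Require Import Defs.
From mathcomp Require Import all_boot.

(* Upper bound by induction on n. Colour K_{3 x (n+1)} without blue C_7. Deleting
   any transversal leaves a K_{3 x n}, which contains a red nK_2 by induction; in
   particular there is a red edge uv. Deleting a transversal through u and v
   yields a red nK_2 avoiding u and v, and uv completes it to a red (n+1)K_2.
   The base case n = 3 is a branching search: given the edges already known to be
   red, pick a 7-cycle avoiding them; if it is not blue, one of its edges is red,
   and one branches on the first such edge until three disjoint red edges appear.
   Lower bound: for s < n, colour red the edges of K_{3 x s} that meet a fixed
   class; that class covers the red edges and the blue graph is bipartite. *)

Set Implicit Arguments.
Unset Strict Implicit.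
Unset Printing Implicit Defensive.

(** * Computable search for the base case *)

Definition disjoint_edges (T : eqType) (e f : T * T) : bool :=
  [&& e.1 != f.1, e.1 != f.2, e.2 != f.1 & e.2 != f.2].

(* The search uses [if] instead of [&&] and [||] because vm_compute is
   call-by-value and would evaluate both operands. *)
Fixpoint has_matching (T : eqType) (k : nat) (s : seq (T * T)) : bool :=
  if k is k'.+1 then
    let fix try s :=
      if s is e :: s' then
        if has_matching k' (filter (disjoint_edges e) s') then true else try s'
      else false
    in try s
  else true.

Definition mem_edge (e : nat * nat) (s : seq (nat * nat)) : bool :=
  if e \in s then true else (e.2, e.1) \in s.

(* In K_{3 x 3}, the number v < 9 stands for vertex v %/ 3 of class v %% 3. *)
Definition edge33 (e : nat * nat) : bool :=
  [&& e.1 < 9, e.2 < 9 & e.1 %% 3 != e.2 %% 3].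

Definition allowed (R : seq (nat * nat)) (x y : nat) : bool :=
  if x %% 3 == y %% 3 then false else ~~ mem_edge (x, y) R.

(* Extends the reversed path [x :: p] by [k] more vertices and closes it; the
   result is [::] on failure. Nothing is proved about this search, since its
   output is checked by [valid_cycle]. *)
Fixpoint find_cycle (R : seq (nat * nat)) (vs : seq nat) (k x : nat)
    (p : seq nat) : seq nat :=
  if k is k'.+1 then
    let fix try s :=
      if s is y :: s' then
        if y \in x :: p then try s' else
        if allowed R x y then
          if find_cycle R vs k' y (x :: p) is a :: q then a :: q else try s'
        else try s'
      else [::]
    in try vs
  else if allowed R (last x p) x then x :: p else [::].

Definition degree_in (R : seq (nat * nat)) (x : nat) : nat :=
  count (fun e => if x == e.1 then true else x == e.2) R.

(* Starting at, and preferring, vertices of small degree in [R] keeps the search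
   tree small. *)
Definition avoiding_cycle (R : seq (nat * nat)) : seq nat :=
  let vs := sort (fun x y => degree_in R x <= degree_in R y) (iota 0 9) in
  find_cycle R vs 6 (head 0 vs) [::].

(** Edges are not compared with [R]: soundness only asks for a genuine 7-cycle of K_{3 x 3}. *)
Definition valid_cycle (p : seq nat) :=
  [&& size p == 7, uniq p & cycle (fun x y => edge33 (x, y)) p].

(* [R] and [B] are the edges known to be red and blue; [refutes k R B] says that
   every colouring extending them has a red 3K_2 or a blue C_7. *)
Fixpoint refutes (k : nat) (R B : seq (nat * nat)) : bool :=
  if has_matching 3 R then true else
  if k is k'.+1 then
    let p := avoiding_cycle R in
    if valid_cycle p then
      let fix branch s B :=
        if s is e :: s' then
          if mem_edge e B then branch s' B else
          if refutes k' (e :: R) B then branch s' (e :: B) else false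
        else true
      in branch (zip p (rot 1 p)) B
    else false
  else false.

(** * Copies of matchings and cycles given by lists *)

Lemma contains_copy_trans (G H K : sgraph) :
  contains_copy G H -> contains_copy H K -> contains_copy G K.
Proof.
case=> f f_inj f_adj [g g_inj g_adj].
by exists (f \o g) => [|x y /g_adj/f_adj //]; exact: inj_comp.
Qed.

(** The two ends of an edge differ because [adj] is irreflexive, ends of different edges because the
    edges are disjoint. *)
Lemma contains_matching (G : sgraph) (s : seq (G * G)) :
  all (fun e => adj e.1 e.2) s -> pairwise (@disjoint_edges G) s ->
  contains_copy G (matching_graph (size s)).
Proof.
move=> s_adj s_disj.
pose end_of (b : bool) (e : G * G) := if b then e.2 else e.1.
have adj_e (i : 'I_(size s)) :
    adj (tnth (in_tuple s) i).1 (tnth (in_tuple s) i).2.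
  exact: (allP s_adj) (mem_tnth i (in_tuple s)).
have end_inj (i : 'I_(size s)) b b' : end_of b (tnth (in_tuple s) i) =
    end_of b' (tnth (in_tuple s) i) -> b = b'.
  have := adj_e i; rewrite /end_of.
  by case: b b' => [] [] // + eq_e; rewrite eq_e adj_irrefl.
have disj (i j : 'I_(size s)) : i < j ->
    disjoint_edges (tnth (in_tuple s) i) (tnth (in_tuple s) j).
  move=> lt_ij; have e0 := tnth (in_tuple s) i.
  rewrite !(tnth_nth e0); apply: (pairwiseP e0 s_disj) => //; exact: ltn_ord.
exists (fun x => end_of x.2 (tnth (in_tuple s) x.1)).
  move=> [i b] [j b'] /= eq_end.
  case: (ltngtP i j) => [/disj|/disj|/val_inj eq_ij].
  - by case/and4P; move: eq_end; rewrite /end_of; case: b b' => [] [] ->;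
      rewrite eqxx.
  - by case/and4P; move: eq_end; rewrite /end_of; case: b b' => [] [] ->;
      rewrite eqxx.
  by move: eq_end; rewrite eq_ij => /end_inj->.
move=> [i b] [j b'] /andP[/= /eqP <-]; rewrite /end_of.
by case: b b' => [] [] // _; rewrite ?(adj_sym (tnth _ i).2); exact: adj_e.
Qed.

Lemma contains_cycle (G : sgraph) (p : seq G) :
  uniq p -> cycle (@adj G) p -> contains_copy G (cycle_graph (size p)).
Proof.
move=> p_uniq p_cycle.
have adj_next x0 k : k < size p -> adj (nth x0 p k) (nth x0 p (k.+1 %% size p)).
  move=> lt_kp; have := next_cycle p_cycle (mem_nth x0 lt_kp).
  rewrite next_nth mem_nth // index_uniq //.
  case: (p) lt_kp => //= y q; rewrite ltnS leq_eqVlt.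
  (* At the last index, [next_nth] reads past the end of [q] and returns its default, the head
     [y]. *)
  case/predU1P=> [->|lt_kq].
    by rewrite modnn (nth_default y).
  by rewrite modn_small //= (set_nth_default x0).
have adj_succ (i j : 'I_(size p)) : j == i.+1 %[mod size p] ->
    adj (tnth (in_tuple p) i) (tnth (in_tuple p) j).
  rewrite (modn_small (ltn_ord j)) => /eqP j_def.
  have x0 := tnth (in_tuple p) i.
  by rewrite !(tnth_nth x0) j_def; exact: adj_next.
exists (tnth (in_tuple p)).
  move=> i j; have x0 := tnth (in_tuple p) i.
  rewrite !(tnth_nth x0) => /eqP; rewrite nth_uniq //.
  by move/eqP/val_inj.
move=> i j /andP[_ /orP[]/adj_succ //].
by rewrite adj_sym.
Qed.

(** * Soundness and run of the search *)

Lemma has_matchingP (T : eqType) (k : nat) (s : seq (T * T)) :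
  has_matching k s ->
  exists m, [/\ {subset m <= s}, size m = k & pairwise (@disjoint_edges T) m].
Proof.
elim: k s => [|k IHk] s; first by exists [::].
elim: s => //= e s IHs.
case: ifP => [/IHk[m [m_sub m_size m_disj]] _|_ /IHs[m [m_sub m_size m_disj]]].
  exists (e :: m); split=> /=; last 2 first.
  - by rewrite m_size.
  - rewrite m_disj andbT; apply/allP=> f /m_sub.
    by rewrite mem_filter => /andP[].
  move=> f; rewrite !inE => /predU1P[->|/m_sub]; first by rewrite eqxx.
  by rewrite mem_filter orbC => /andP[_ ->].
by exists m; split=> // f /m_sub; rewrite inE orbC => ->.
Qed.

Arguments has_matching : simpl never.

Lemma cycle_all_zip (T : Type) (e : rel T) (p : seq T) :
  cycle e p = all (fun a => e a.1 a.2) (zip p (rot 1 p)).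
Proof.
(* The closing vertex must stay fixed while the start of the path moves along the induction. *)
case: p => //= x p; rewrite rot1_cons; move: {2 4}x => y.
by elim: p x => [|z p IHp] x //=; rewrite IHp.
Qed.

Section Refutation.
Variable red : rel nat.
Hypothesis red_sym : symmetric red.

Let red_edge (e : nat * nat) := edge33 e && red e.1 e.2.

Let conclusion :=
  (exists m, [/\ size m = 3, all red_edge m & pairwise (@disjoint_edges nat) m])
  \/ exists2 p, valid_cycle p & cycle (fun x y => ~~ red x y) p.

Lemma refutesP (k : nat) (R B : seq (nat * nat)) :
  refutes k R B -> all red_edge R -> all (fun e => ~~ red e.1 e.2) B ->
  conclusion.
Proof.
elim: k R B => [|k IHk] R B /=; case: ifP => //.
1,2: case/has_matchingP=> m [m_sub m_size m_disj] _ redR _; left; exists m.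
1,2: by split=> //; apply/allP=> e /m_sub/(allP redR).
move=> _; set p := avoiding_cycle R.
case: ifP => // p_valid branchP redR blueB.
have edge_p : all edge33 (zip p (rot 1 p)).
  by case/and3P: p_valid => _ _; rewrite cycle_all_zip; apply: sub_all => -[].
suff [] : conclusion \/ all (fun e => ~~ red e.1 e.2) (zip p (rot 1 p)) => //.
  by move=> blue_p; right; exists p; rewrite ?cycle_all_zip.
(* Walk along the cycle: [B] varies because it collects the blue edges passed, and the first red
   edge is handed to [IHk]. *)
elim: (zip p _) B branchP blueB edge_p => [|e s IHs] B; first by right.
case: ifP => [eB branch_s blueB /andP[_ edge_s]|_].
  have [|blue_s] := IHs B branch_s blueB edge_s; [by left | right] => /=.
  rewrite blue_s andbT; move: eB; rewrite /mem_edge.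
  by case: ifP => [/(allP blueB)//|_ /(allP blueB)]; rewrite red_sym.
case: ifP => // refutes_e branch_s blueB /andP[edge_e edge_s].
have [red_e|blue_e] := boolP (red e.1 e.2).
  left; apply: IHk refutes_e _ blueB.
  by rewrite /= redR /red_edge edge_e red_e.
have [||blue_s] := IHs (e :: B) branch_s _ edge_s.
- by rewrite /= blue_e.
- by left.
by right; rewrite /= blue_e.
Qed.

End Refutation.

(** Each nested call adds one edge to [R], so 12 bounds the number of red edges on a branch. *)
Lemma refutes_empty : refutes 12 [::] [::].
Proof. by vm_compute. Qed.

(** * The base case n = 3 *)

Lemma arrows_C7_3 :
  arrows (complete_multipartite 3 3) (matching_graph 3) (cycle_graph 7).
Proof.
move=> c.
pose F (v : nat) : complete_multipartite 3 3 :=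
  (inord (v %% 3), inord (v %/ 3)).
(* Beyond 9 vertices [inord] falls back to a default, hence the restriction. *)
have F_inj : {in gtn 9 &, injective F}.
  move=> v w; rewrite !inE => v9 w9 [/(congr1 val) + /(congr1 val)].
  rewrite /= !inordK ?ltn_mod ?ltn_divLR // => eq_mod eq_div.
  by rewrite (divn_eq v 3) eq_mod eq_div -divn_eq.
have F_adj v w : edge33 (v, w) -> adj (F v) (F w).
  case/and3P=> _ _ /=; apply: contraNneq => /(congr1 val).
  by rewrite /= !inordK ?ltn_mod // => ->.
pose red v w := c [set F v; F w].
have red_sym : symmetric red by move=> v w; rewrite /red setUC.
have [[m [m_size m_red m_disj]]|[p p_valid p_blue]] :=
  refutesP red_sym refutes_empty isT isT.
- left; suff: contains_copy (color_class c true)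
      (matching_graph (size [seq (F e.1, F e.2) | e <- m])).
    by rewrite size_map m_size.
  apply: contains_matching.
    rewrite all_map; apply: sub_all m_red => -[v w] /andP[/= vw_edge vw_red].
    by rewrite /color_adj F_adj //=; apply/eqP.
  rewrite pairwise_map; apply: (sub_in_pairwise _ m_red m_disj).
  move=> [v w] [v' w'] /andP[/and3P[/= v9 w9 _] _] /andP[/and3P[/= v9' w9' _] _].
  by rewrite /disjoint_edges /= !(inj_in_eq F_inj).
- case/and3P: p_valid => /eqP p_size p_uniq p_edge.
  right; rewrite -p_size -(size_map F); apply: contains_cycle.
    (* A vertex of [p] is below 9 as an end of an edge satisfying [edge33]. *)
    rewrite map_inj_in_uniq // => v w pv pw; apply: F_inj; rewrite inE.
      by case/and3P: (next_cycle p_edge pv).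
    by case/and3P: (next_cycle p_edge pw).
  rewrite cycle_map cycle_all_zip; move: p_edge p_blue; rewrite !cycle_all_zip.
  move=> /allP p_edge /allP p_blue; apply/allP=> e pe.
  by rewrite /= /color_adj F_adj ?eqbF_neg ?p_blue // p_edge.
Qed.

(** * The induction step *)

Lemma contains_matching_cons (G : sgraph) (n : nat) (u v : G)
    (f : matching_graph n -> G) :
  injective f -> (forall x y, adj x y -> adj (f x) (f y)) ->
  adj u v -> (forall x, f x != u) -> (forall x, f x != v) ->
  contains_copy G (matching_graph n.+1).
Proof.
move=> f_inj f_adj uv f_u f_v.
pose h (x : 'I_n.+1 * bool) : G :=
  if unlift ord0 x.1 is Some i then f (i, x.2) else if x.2 then u else v.
have uv_neq : u != v by apply: contraTneq uv => ->; rewrite adj_irrefl.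
have vu_neq : v != u by rewrite eq_sym.
exists h => [[i b] [j b']|[i b] [j b']]; rewrite /h /=.
  case: unliftP => [i'|] ->; case: unliftP => [j'|] -> //=.
  - by move/f_inj => [-> ->].
  - by case: b' => /eqP; rewrite (negPf (f_u _), negPf (f_v _)).
  - by case: b => /esym/eqP; rewrite (negPf (f_u _), negPf (f_v _)).
  - by case: b b' => [] [] // /eqP; rewrite ?(negPf uv_neq) ?(negPf vu_neq).
case/andP=> /= /eqP <-; case: unliftP => [i' _|_] bb'.
  by apply: f_adj; rewrite /= /matching_adj eqxx.
by case: b b' bb' => [] [] // _; rewrite // adj_sym.
Qed.

Section Induction.
Variables (n : nat) (c : {set complete_multipartite 3 n.+1} -> bool).

Let K := complete_multipartite 3 n.
Let K' := complete_multipartite 3 n.+1.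

(** The transversal [x] selects the vertex deleted from each class; [lift] skips its index. *)
Let avoid (x : 'I_3 -> 'I_n.+1) (v : K) : K' := (v.1, lift (x v.1) v.2).

Let avoid_inj x : injective (avoid x).
Proof.
move=> [a i] [b j] eq_ij; have /= eq_ab := congr1 fst eq_ij.
by case: b / eq_ab j eq_ij => j /(congr1 snd)/lift_inj /= ->.
Qed.

Hypothesis IHn : arrows K (matching_graph n) (cycle_graph 7).

(** Apply [IHn] to the colouring pulled back along [avoid x], whose image misses the transversal. *)
Lemma arrows_avoid (x : 'I_3 -> 'I_n.+1) :
  contains_copy (color_class c false) (cycle_graph 7) \/
  exists f : matching_graph n -> color_class c true,
    [/\ injective f, forall y z, adj y z -> adj (f y) (f z)
      & forall y, (f y).2 != x (f y).1].
Proof.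
have copy : contains_copy (color_class c false)
    (color_class (fun A : {set K} => c (avoid x @: A)) false).
  exists (avoid x) => // v w /andP[vw]; rewrite imsetU !imset_set1 => c_vw.
  by apply/andP.
have [[f f_inj f_adj]|C7] := IHn (fun A => c (avoid x @: A)); last first.
  by left; exact: contains_copy_trans copy C7.
right; exists (avoid x \o f); split=> [|y z /f_adj|y].
- exact: inj_comp.
- by case/andP=> vw; rewrite imsetU !imset_set1 => c_vw; apply/andP.
- by rewrite /= eq_sym neq_lift.
Qed.

End Induction.

Lemma arrows_step (n : nat) : 0 < n ->
  arrows (complete_multipartite 3 n) (matching_graph n) (cycle_graph 7) ->
  arrows (complete_multipartite 3 n.+1) (matching_graph n.+1) (cycle_graph 7).
Proof.
move=> n_gt0 IHn c.
have [|[f [_ f_adj _]]] := arrows_avoid c IHn (fun=> ord0); first by right.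
pose i0 := Ordinal n_gt0.
have := f_adj (i0, false) (i0, true); rewrite /= /matching_adj eqxx => /(_ isT).
move: (f _) (f _) => v u uv; have /andP[/= u1v1 _] := uv.
(* One transversal can contain both [u] and [v] since they lie in different classes; its vertex in
   the third class is arbitrary. *)
have [|[g [g_inj g_adj g_avoid]]] :=
  arrows_avoid c IHn (fun a => if a == u.1 then u.2 else v.2); first by right.
left; apply: (contains_matching_cons g_inj g_adj uv) => y;
  apply: contraTneq (g_avoid y) => ->.
  by rewrite /= eqxx negbK.
by rewrite /= [v.1 == _]eq_sym (negPf u1v1) eqxx.
Qed.

Lemma arrows_C7 (n : nat) : 3 <= n ->
  arrows (complete_multipartite 3 n) (matching_graph n) (cycle_graph 7).
Proof.
elim: n => // n IHn; rewrite leq_eqVlt => /predU1P[[<-]|].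
  exact: arrows_C7_3.
rewrite ltnS => n_ge3; apply: arrows_step (IHn n_ge3).
exact: leq_trans n_ge3.
Qed.

(** * The lower bound and the theorem *)

Lemma not_contains_odd_cycle (G : sgraph) (k : nat) (h : G -> bool) :
  odd k -> 1 < k -> (forall x y, adj x y -> h x != h y) ->
  ~ contains_copy G (cycle_graph k).
Proof.
case: k => // k k_odd k_gt1 h_adj [f _ f_adj].
have h_parity i : i <= k -> h (f (inord i)) = h (f ord0) (+) odd i.
  elim: i => [_|i IHi lt_ik].
    by rewrite addbF; congr (h (f _)); apply: val_inj; rewrite /= inordK.
  have := h_adj _ _ (f_adj (inord i) (inord i.+1) _).
  rewrite /= /cycle_adj -val_eqE /= !inordK ?ltnS ?(ltnW lt_ik) //.
  rewrite (ltn_eqF (ltnSn i)) eqxx IHi ?(ltnW lt_ik) // addbN => /(_ isT).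
  by do 2!case: (h _); case: (odd i).
(* Here [k] is even, so the closing edge joins two vertices with the same value of [h]. *)
have /f_adj/h_adj : @adj (cycle_graph k.+1) (inord k) ord0.
  rewrite /= /cycle_adj -val_eqE /= inordK // modnn mod0n eqxx andbT.
  by rewrite -lt0n.
by rewrite h_parity // (negbTE k_odd : odd k = false) addbF eqxx.
Qed.

Unset Implicit Arguments.

Theorem theorem7 (n : nat) (hn : 3 <= n) :
  multipartite_ramsey 3 (matching_graph n) (cycle_graph 7) n.
Proof.
split=> [||s s_gt0 arrows_s]; [exact: leq_trans hn | exact: arrows_C7|].
pose c (A : {set complete_multipartite 3 s}) := [exists v in A, v.1 == ord0].
have [[f f_inj f_adj]|C7] := arrows_s c.
  have hub (i : 'I_n) : exists b, (f (i, b)).1 == ord0.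
    have /f_adj/andP[_ /eqP] : @adj (matching_graph n) (i, false) (i, true).
      by rewrite /= /matching_adj eqxx.
    case/existsP=> v; rewrite !inE => /andP[/orP[]/eqP-> f_hub].
      by exists false.
    by exists true.
  pose b i := xchoose (hub i).
  rewrite -(card_ord n) -(card_ord s).
  (* The chosen ends all lie in class 0, so their indices alone tell the n edges apart. *)
  apply: (leq_card (fun i => (f (i, b i)).2)) => i j eq_ij.
  suff /f_inj[] : f (i, b i) = f (j, b j) by [].
  rewrite [LHS]surjective_pairing [RHS]surjective_pairing eq_ij.
  by rewrite (eqP (xchooseP (hub i))) (eqP (xchooseP (hub j))).
(* Blue edges run between classes 1 and 2, so membership in class 1 is a proper 2-colouring. *)
pose h (v : 'I_3 * 'I_s) := v.1 == inord 1.
case: (@not_contains_odd_cycle (color_class c false) 7 h _ _ _ C7) => //.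
move=> v w /andP[/= vw /eqP/negbT/existsPn c_vw].
have := c_vw v; have := c_vw w; rewrite !inE !eqxx orbT /=.
move: vw; rewrite /h /multipartite_adj -!val_eqE /= inordK //.
by case: v.1 w.1 => [[|[|[|]]] //= _] [[|[|[|]]] //= _].
Qed.
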